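(* Let $f:\mathbb{R}^n\to\mathbb{R}$ be a continuous loss function which is $\mu$-strongly convex and $L$-smooth, with global minimum $w^*$. Assume the stochastic gradient is unbiased, $\mathbb{E}(\nabla_{mb}f(w))=\nabla f(w)$, and has bounded variance. Then sequences $(w_i)$ generated by the Loss-Guarded L2O algorithm using stochastic gradient descent with step sizes $\frac{\alpha_i}{L}$, where $\alpha_i\propto\frac{1}{i_0+i}$ for a constant $i_0>0$, as the guarding mechanism converge to $w^*$: $\lim_{i\to\infty}w_i=w^*$.
   Context: $\nabla_{mb}f(w)$ denotes a random mini-batch stochastic gradient of $f$ at $w$. Loss-Guarded L2O algorithm with stochastic gradient descent: at each step $i$, an arbitrary black-box rule proposes a point $y_i$, the fallback proposes $z_i=w_i-\frac{\alpha_i}{L}\nabla_{mb}f(w_i)$ (with a freshly sampled stochastic gradient), and $w_{i+1}=y_i$ if $f(y_i)<f(z_i)$, otherwise $w_{i+1}=z_i$. $L$-smooth: $f(y)\le f(x)+\langle\nabla f(x),y-x\rangle+\frac{L}{2}\|y-x\|_2^2$; $\mu$-strongly convex: $f(y)\ge f(x)+\langle\nabla f(x),y-x\rangle+\frac{\mu}{2}\|y-x\|_2^2$, for all $x,y$. *)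

(* Defs.v *)
From HB Require Import structures.
From mathcomp Require Import all_boot all_order all_algebra.
From mathcomp Require Import all_classical all_reals all_analysis.
Set Implicit Arguments. Unset Strict Implicit. Unset Printing Implicit Defensive.
Import Order.TTheory GRing.Theory Num.Theory.
Import numFieldNormedType.Exports.
Local Open Scope classical_set_scope.
Local Open Scope ring_scope.

Section LGL2O.
Variables (R : realType) (n : nat).

Definition dotp (u v : 'rV[R]_n) : R := \sum_(j < n) u ord0 j * v ord0 j.
Definition sqnorm2 (u : 'rV[R]_n) : R := dotp u u.

Definition is_gradient (f : 'rV[R]_n -> R) (grad : 'rV[R]_n -> 'rV[R]_n) :=
  forall x, differentiable f x /\ forall v, 'd f x v = dotp (grad x) v.

Definition L_smooth (f : 'rV[R]_n -> R) (grad : 'rV[R]_n -> 'rV[R]_n) (L : R) :=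
  forall x y, f y <= f x + dotp (grad x) (y - x) + L / 2 * sqnorm2 (y - x).

Definition strongly_convex (f : 'rV[R]_n -> R) (grad : 'rV[R]_n -> 'rV[R]_n) (mu : R) :=
  forall x y, f y >= f x + dotp (grad x) (y - x) + mu / 2 * sqnorm2 (y - x).

Definition rVborel : Type := g_sigma_algebraType (@open 'rV[R]_n).
End LGL2O.

Definition measurable_wrt {d} {T : measurableType d} {dX} {X : measurableType dX}
  (F : set (set T)) (h : T -> X) : Prop :=
  forall B : set X, measurable B -> F (h @^-1` B).

Definition rV_measurable_wrt {d} {T : measurableType d} {R : realType} {n : nat}
  (F : set (set T)) (h : T -> 'rV[R]_n) : Prop :=
  forall j : 'I_n, measurable_wrt F (fun t => h t ord0 j).

Definition filtration {d} {T : measurableType d} (F : nat -> set (set T)) : Prop :=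
  (forall i, sigma_algebra setT (F i)) /\
  (forall i, F i `<=` measurable) /\
  (forall i, F i `<=` F i.+1).

Definition indep_of {d} {T : measurableType d} {R : realType} (P : probability T R)
  {dX} {X : measurableType dX} (h : T -> X) (F : set (set T)) : Prop :=
  forall A (B : set X), F A -> measurable B ->
    P (A `&` h @^-1` B) = (P A * P (h @^-1` B))%E.

(** Loss-Guarded L2O iterates with the SGD fallback.
    [g w s] is the mini-batch stochastic gradient at [w] for the sample [s];
    [xi i] is the fresh sample drawn at step [i]; [y i] is the black-box proposal. *)
Fixpoint lgl2o {T : Type} {Xi : Type} {R : realType} {n : nat}
  (f : 'rV[R]_n -> R) (g : 'rV[R]_n -> Xi -> 'rV[R]_n) (L : R) (alpha : nat -> R)
  (y : nat -> T -> 'rV[R]_n) (xi : nat -> T -> Xi) (w0 : 'rV[R]_n) (i : nat) (t : T)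
  : 'rV[R]_n :=
  match i with
  | 0 => w0
  | i'.+1 =>
      let w := lgl2o f g L alpha y xi w0 i' t in
      let z := w - (alpha i' / L) *: g w (xi i' t) in
      if f (y i' t) < f z then y i' t else z
  end.

(* Main.v *)
(** The expected optimality gap [e_i = E (f (w_i) - f wstar)] is a Lyapunov function:
    the guard only ever decreases [f] below its value at the SGD fallback, so the
    black-box proposals drop out and [e_i] obeys the SGD recursion.  Conditioning
    on the past (by independence, freezing [w_i] and integrating over the fresh
    sample), smoothness and the Polyak-Lojasiewicz inequality give
    [e_{i+1} <= (1 - kappa alpha_i) e_i + alpha_i^2 sigma^2 / (2 L)] as soon as
    [alpha_i <= 1], while for the finitely many larger steps [e_i] at least stays
    finite.  Since [sum alpha_i] diverges and [alpha_i -> 0], [e_i -> 0], and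
    strong convexity bounds [E |w_i - wstar|^2] by [2 e_i / mu]. *)
Require Import Defs.
From HB Require Import structures.
From mathcomp Require Import all_boot all_order all_algebra.
From mathcomp Require Import all_classical all_reals all_analysis.
From mathcomp Require Import measurable_realfun.
From mathcomp Require Import ring lra.
Import Order.TTheory GRing.Theory Num.Theory.
Import numFieldNormedType.Exports.
Local Open Scope classical_set_scope.
Local Open Scope ring_scope.
Set Implicit Arguments. Unset Strict Implicit. Unset Printing Implicit Defensive.

(** * Euclidean inner product and squared norm on row vectors *)

Section dotp_theory.
Context {R : realType} {n : nat}.
Implicit Types (u v w : 'rV[R]_n) (a : R).

Lemma dotpC u v : dotp u v = dotp v u.
Proof. by apply: eq_bigr => j _; rewrite mulrC. Qed.

Lemma dotpDr u v w : dotp u (v + w) = dotp u v + dotp u w.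
Proof. by rewrite -big_split; apply: eq_bigr => j _; rewrite mxE mulrDr. Qed.

Lemma dotpZr a u v : dotp u (a *: v) = a * dotp u v.
Proof. by rewrite mulr_sumr; apply: eq_bigr => j _; rewrite mxE mulrCA. Qed.

Lemma dotpNr u v : dotp u (- v) = - dotp u v.
Proof. by rewrite -scaleN1r dotpZr mulN1r. Qed.

Lemma sqnorm2_ge0 u : 0 <= sqnorm2 u.
Proof. by apply: sumr_ge0 => j _; rewrite -expr2 sqr_ge0. Qed.

Lemma sqnorm2D u v : sqnorm2 (u + v) = sqnorm2 u + 2 * dotp u v + sqnorm2 v.
Proof.
rewrite /sqnorm2 dotpDr (dotpC _ u) (dotpC _ v) !dotpDr (dotpC v u); ring.
Qed.

Lemma sqnorm2Z a u : sqnorm2 (a *: u) = a ^+ 2 * sqnorm2 u.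
Proof. by rewrite /sqnorm2 dotpZr dotpC dotpZr mulrA -expr2. Qed.

Lemma sqnorm2N u : sqnorm2 (- u) = sqnorm2 u.
Proof. by rewrite -scaleN1r sqnorm2Z sqrrN expr1n mul1r. Qed.

Lemma sqnorm2_eq0 u : sqnorm2 u <= 0 -> u = 0.
Proof.
move=> u0; have /eqP : sqnorm2 u = 0 by apply/le_anti; rewrite u0 sqnorm2_ge0.
rewrite psumr_eq0 => [/allP u0'|j _]; last by rewrite -expr2 sqr_ge0.
apply/rowP => j; rewrite mxE.
by have := u0' j (mem_index_enum _); rewrite /= mulf_eq0 orbb => /eqP.
Qed.

End dotp_theory.

(** * Deterministic inequalities for smooth, strongly convex functions *)

Section smooth_strongly_convex.
Context {R : realType} {n : nat}.
Variables (f : 'rV[R]_n -> R) (grad : 'rV[R]_n -> 'rV[R]_n).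

(** Minimising the strong convexity lower bound over the displacement [d] costs at most
    [sqnorm2 (grad x) / (2 * mu)]. The minimisation is done by completing the square
    [sqnorm2 (grad x + mu *: d)]. *)
Lemma strongly_convex_PL (mu : R) (x w : 'rV[R]_n) : 0 < mu ->
  strongly_convex f grad mu -> 2 * mu * (f x - f w) <= sqnorm2 (grad x).
Proof.
move=> mu0 /(_ x w); set d := w - x => sc.
have := sqnorm2_ge0 (grad x + mu *: d).
rewrite sqnorm2D dotpZr sqnorm2Z.
have : 2 * mu * (f x + dotp (grad x) d + mu / 2 * sqnorm2 d) <= 2 * mu * f w.
  by rewrite ler_pM2l ?mulr_gt0.
have -> : 2 * mu * (f x + dotp (grad x) d + mu / 2 * sqnorm2 d) =
  2 * mu * f x + 2 * (mu * dotp (grad x) d) + mu ^+ 2 * sqnorm2 d by field.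
lra.
Qed.

Lemma L_smooth_step (L a : R) (x v : 'rV[R]_n) : 0 < L -> L_smooth f grad L ->
  f (x - (a / L) *: v) <=
    f x - a / L * dotp (grad x) v + a ^+ 2 / (2 * L) * sqnorm2 v.
Proof.
move=> L0 /(_ x (x - (a / L) *: v)).
have -> : x - (a / L) *: v - x = - ((a / L) *: v) by rewrite addrAC subrr add0r.
rewrite dotpNr dotpZr sqnorm2N sqnorm2Z.
suff -> : L / 2 * ((a / L) ^+ 2 * sqnorm2 v) = a ^+ 2 / (2 * L) * sqnorm2 v by [].
by field; lra.
Qed.

(** An exact gradient step of length [1 / L] lowers [f] by at least [sqnorm2 (grad x) / (2 * L)],
    yet cannot go below the minimum. *)
Lemma L_smooth_grad_le (L : R) (x wstar : 'rV[R]_n) : 0 < L ->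
  L_smooth f grad L -> (forall w, f wstar <= f w) ->
  sqnorm2 (grad x) <= 2 * L * (f x - f wstar).
Proof.
move=> L0 sm hmin; have h := L_smooth_step 1 x (grad x) L0 sm.
have {h} := le_trans (hmin _) h; rewrite -/(sqnorm2 _) => h.
have : 2 * L * f wstar <= 2 * L * (f x - 1 / L * sqnorm2 (grad x) +
    1 ^+ 2 / (2 * L) * sqnorm2 (grad x)) by rewrite ler_pM2l// mulr_gt0.
have -> : 2 * L * (f x - 1 / L * sqnorm2 (grad x) +
    1 ^+ 2 / (2 * L) * sqnorm2 (grad x)) = 2 * L * f x - sqnorm2 (grad x).
  by field; lra.
lra.
Qed.

(** The gradient bound at [wstar] forces [grad wstar = 0], so strong convexity based at [wstar] has
    no linear term. *)
Lemma quadratic_growth (mu L : R) (wstar w : 'rV[R]_n) : 0 < L ->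
  strongly_convex f grad mu -> L_smooth f grad L ->
  (forall w, f wstar <= f w) ->
  mu / 2 * sqnorm2 (w - wstar) <= f w - f wstar.
Proof.
move=> L0 /(_ wstar w) sc sm hmin.
have g0 : grad wstar = 0.
  apply: sqnorm2_eq0; apply: le_trans (L_smooth_grad_le wstar L0 sm hmin) _.
  by rewrite subrr mulr0.
by move: sc; rewrite g0 dotpC -(scale0r 0) dotpZr mul0r addr0 lerBrDl.
Qed.

(** A crude bound valid for steps of any size: the term [- a / L] is dropped and the gradient
    bounded through smoothness. It serves to keep the expected gap finite. *)
Lemma descent_le (L a : R) (wstar w : 'rV[R]_n) : 0 < L -> 0 <= a ->
  L_smooth f grad L -> (forall w, f wstar <= f w) ->
  f w - f wstar + (a ^+ 2 / (2 * L) - a / L) * sqnorm2 (grad w) <=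
  (1 + a ^+ 2) * (f w - f wstar).
Proof.
move=> L0 a0 sm hmin; rewrite [leRHS]mulrDl mul1r lerD2l.
apply: (@le_trans _ _ (a ^+ 2 / (2 * L) * sqnorm2 (grad w))).
  by rewrite ler_wpM2r ?sqnorm2_ge0// gerBl divr_ge0// ltW.
rewrite -mulrA; apply: ler_wpM2l; first exact: sqr_ge0.
by rewrite mulrC ler_pdivrMr ?mulr_gt0// mulrC; exact: L_smooth_grad_le.
Qed.

(** For [a <= 1] the gradient coefficient is at most [- a / (2 * L)], and the Polyak-Lojasiewicz
    inequality turns it into a contraction. Capping the rate at 1 keeps the factor nonnegative
    without comparing [mu] and [L]. *)
Lemma descent_contract (mu L a : R) (wstar w : 'rV[R]_n) :
  0 < mu -> 0 < L -> 0 <= a <= 1 -> strongly_convex f grad mu ->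
  (forall w, f wstar <= f w) ->
  f w - f wstar + (a ^+ 2 / (2 * L) - a / L) * sqnorm2 (grad w) <=
  (1 - a * Num.min (mu / L) 1) * (f w - f wstar).
Proof.
move=> mu0 L0 /andP[a0 a1] sc hmin; rewrite [leRHS]mulrBl mul1r lerD2l.
have D0 : 0 <= f w - f wstar by rewrite subr_ge0.
have aL0 : 0 <= a / (2 * L) by rewrite divr_ge0// mulr_ge0// ltW.
apply: (@le_trans _ _ (- (a / (2 * L)) * sqnorm2 (grad w))).
  rewrite ler_wpM2r ?sqnorm2_ge0//.
  have -> : a ^+ 2 / (2 * L) - a / L = - (a / (2 * L)) - a / (2 * L) * (1 - a).
    by field; lra.
  by rewrite gerBl mulr_ge0// subr_ge0.
rewrite mulNr lerN2.
apply: (@le_trans _ _ (a / (2 * L) * (2 * mu * (f w - f wstar)))).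
  have -> : a / (2 * L) * (2 * mu * (f w - f wstar)) =
    a * (mu / L) * (f w - f wstar) by field; lra.
  by rewrite ler_wpM2r// ler_wpM2l// ge_min lexx.
by apply: ler_wpM2l => //; exact: strongly_convex_PL.
Qed.

End smooth_strongly_convex.

(** * Real sequences obeying the SGD recursion *)

Section recursion.
Context {R : realType}.

Lemma series_harmonic_cvgy : series (@harmonic R) @ \oo --> +oo.
Proof.
apply: nondecreasing_dvgn_lt; last exact: dvg_harmonic.
by apply: nondecreasing_series => i _ _; exact: harmonic_ge0.
Qed.

(* [1 / (1 - b) >= 1 + b] turns the product of the contraction factors
   into the reciprocal of a sum, which the harmonic series makes diverge. *)
Lemma contraction_prod_le (u b : R^nat) :
  (forall i, 0 <= b i <= 1) -> (forall i, u i.+1 <= (1 - b i) * u i) ->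
  forall m, u m * (1 + series b m) <= Num.max (u 0%N) 0.
Proof.
move=> b01 hu m.
have S0 i : 0 <= series b i.
  by apply: sumr_ge0 => j _; case/andP: (b01 j).
elim: m => [|m IH].
  by rewrite /series /= big_geq// addr0 mulr1 le_max lexx.
have /andP[b0 b1] := b01 m.
have S1 := S0 m; have := S0 m.+1.
rewrite seriesSr => S2.
(* [u] may be negative; once it is nonpositive it stays so, which the 0 in the maximum covers. *)
have [um|um] := leP (u m) 0.
  apply: (@le_trans _ _ 0); last by rewrite le_max lexx orbT.
  apply: mulr_le0_ge0; last by lra.
  apply: le_trans (hu m) _; apply: mulr_ge0_le0; lra.
apply: le_trans IH.
have : u m.+1 * (1 + (series b m + b m)) <=
   (1 - b m) * u m * (1 + (series b m + b m)).
  by apply: ler_wpM2r (hu m); lra.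
move/le_trans; apply.
have -> : (1 - b m) * u m * (1 + (series b m + b m)) =
  u m * (1 + series b m) - u m * (b m * series b m + b m ^+ 2) by ring.
rewrite gerBl; apply: mulr_ge0; first exact: ltW.
by rewrite addr_ge0 ?mulr_ge0 ?sqr_ge0.
Qed.

Lemma sgd_recursion_cvg0 (x : R^nat) (k C t0 : R) (N : nat) :
  0 < k -> 0 <= C -> 0 < t0 -> (forall i, 0 <= x i) ->
  (forall i, (N <= i)%N -> k / (t0 + i%:R) <= 1) ->
  (forall i, (N <= i)%N ->
     x i.+1 <= (1 - k / (t0 + i%:R)) * x i + C / (t0 + i%:R) ^+ 2) ->
  x @ \oo --> (0 : R).
Proof.
move=> k0 C0 t00 x0 k1 hx.
have tp i : 0 < t0 + i%:R :> R by rewrite ltr_pwDl.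
apply/cvgrPdist_le => e e0.
(* From [M] on, the noise term is at most [e / 2] times the contraction rate [k / (t0 + i%:R)]. *)
have [M [NM hM]] : exists M : nat, (N <= M)%N /\
    forall i, (M <= i)%N -> C / (t0 + i%:R) <= k * (e / 2).
  have q0 : 0 <= C / (k * (e / 2)) by rewrite divr_ge0// !mulr_ge0 ?ltW.
  exists (maxn N (Num.truncn (C / (k * (e / 2)))).+1); split.
    exact: leq_maxl.
  move=> i; rewrite geq_max => /andP[_ hi].
  rewrite ler_pdivrMr// mulrC -ler_pdivrMr; last by rewrite !mulr_gt0.
  apply: (@le_trans _ _ i%:R); last by rewrite lerDr ltW.
  apply: le_trans (ltW (truncnS_gt _)) _.
  by rewrite ler_nat.
pose b i := k / (t0 + (M + i)%:R).
have b01 i : 0 <= b i <= 1.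
  rewrite divr_ge0 ?(ltW k0) ?(ltW (tp _))//=.
  by rewrite k1// (leq_trans NM)// leq_addr.
(* Shifting by [e / 2] absorbs the noise, leaving a pure contraction for [u]. *)
pose u i := x (M + i)%N - e / 2.
have hu i : u i.+1 <= (1 - b i) * u i.
  have Mi : (M <= M + i)%N := leq_addr _ _.
  rewrite /u addnS lerBlDr; apply: le_trans (hx _ (leq_trans NM Mi)) _.
  have -> : (1 - b i) * (x (M + i)%N - e / 2) + e / 2 =
    (1 - k / (t0 + (M + i)%:R)) * x (M + i)%N + b i * (e / 2).
    by rewrite /b; ring.
  rewrite lerD2l expr2 invfM mulrA /b [leRHS]mulrAC.
  by apply: ler_wpM2r; rewrite ?hM// invr_ge0 ltW.
have hprod := contraction_prod_le b01 hu.
(* With this [T], [t0 + (M + j)%:R <= T * j.+1%:R], so the rates dominate [k / T] times the harmonic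
   sequence [1 / (j + 1)]. *)
pose T := t0 + M%:R + 1.
have T0 : 0 < T by rewrite /T ltr_wpDl// ltW.
have hS m : k / T * series harmonic m <= series b m.
  rewrite /series/= mulr_sumr; apply: ler_sum => j _.
  rewrite /b /harmonic -mulrA -invfM ler_pM2l// lef_pV2 ?posrE ?mulr_gt0//.
  rewrite /T natrD -[j.+1%:R]natr1.
  have := ler0n R j; have := ler0n R M => M0 j0.
  rewrite -subr_ge0.
  have -> : (t0 + M%:R + 1) * (j%:R + 1) - (t0 + (M%:R + j%:R)) =
    (t0 + M%:R) * j%:R + 1 by ring.
  by rewrite addr_ge0// mulr_ge0// addr_ge0// ltW.
pose A := Num.max (u 0%N) 0.
have kT : 0 < k / T by rewrite divr_gt0.
(* Past this threshold [e / 2 * series b m] is at least [A], so [u m > e / 2] would contradict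
   [hprod]. *)
have /cvgryPge/(_ (A / (e / 2) / (k / T))) [m0 _ hm0] := series_harmonic_cvgy.
exists (M + m0)%N => // i /= Mi.
have /subnKC <- : (M <= i)%N := leq_trans (leq_addr _ _) Mi.
have {Mi} : (m0 <= i - M)%N by rewrite leq_subRL// (leq_trans (leq_addr _ _) Mi).
move: (i - M)%N => m mm0.
rewrite sub0r normrN ger0_norm//.
have := hprod m; rewrite -/A.
have : A / (e / 2) <= series b m.
  apply: le_trans (hS m); rewrite [leRHS]mulrC -ler_pdivrMr//; exact: hm0.
rewrite ler_pdivrMr ?divr_gt0// => hA hp.
have S0 : 0 <= series b m by apply: sumr_ge0 => j _; case/andP: (b01 j).
rewrite leNgt; apply/negP => ex.
have : e / 2 * (1 + series b m) < u m * (1 + series b m).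
  by rewrite ltr_pM2r /u; lra.
lra.
Qed.

End recursion.

(** * Borel measurability of vector-valued maps through coordinates *)

Section rV_borel.
Context {R : realType} {n : nat}.

(** A sup-norm ball with rational centre, written by coordinates so that its preimage is a finite
    intersection of coordinate events. *)
Definition ratball (c : 'rV[rat]_n) (k : nat) : set 'rV[R]_n :=
  [set x | forall j, ball (ratr (c ord0 j) : R) k.+1%:R^-1 (x ord0 j)].

(** Second countability made explicit. Balls not inside [A] are replaced by [set0], so the union
    runs over a whole countable type. *)
Lemma open_ratball_cover (A : set 'rV[R]_n) : open A ->
  A = \bigcup_(p : 'rV[rat]_n * nat)
        (if `[< ratball p.1 p.2 `<=` A >] then ratball p.1 p.2 else set0).
Proof.
move=> oA; apply/seteqP; split=> [x Ax|x [p _]]; last first.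
  by case: asboolP => // pA; exact: pA.
have /nbhs_ballP[e /= e0 xeA] : nbhs x A by exact: open_nbhs_nbhs.
have [k ke] : exists k : nat, k.+1%:R^-1 < e / 2.
  exists (Num.truncn (e / 2)^-1); rewrite invf_plt ?posrE ?divr_gt0//.
  exact: truncnS_gt.
have k0 : 0 < k.+1%:R^-1 :> R by rewrite invr_gt0.
have /choice[c hc] : forall j, exists q : rat,
    ball (x ord0 j) k.+1%:R^-1 (ratr q).
  move=> j; have [||y [xy [q _ qy]]] := @dense_rat R (ball (x ord0 j) k.+1%:R^-1).
  - by exists (x ord0 j); exact: ballxx.
  - exact: ball_open.
  - by exists q; rewrite qy.
exists (\row_j c j, k) => //=; case: asboolP => [_ j|[]].
  by rewrite mxE; apply: ball_sym.
move=> y yc; apply: xeA; split=> // i j; rewrite ord1 (splitr e).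
apply: ball_triangle; apply: (le_ball (ltW ke)); first exact: hc.
by have := yc j; rewrite mxE.
Qed.

Lemma measurable_rVborel d (T : measurableType d) (h : T -> 'rV[R]_n) :
  (forall j, measurable_fun setT (fun t => h t ord0 j)) ->
  measurable_fun setT (h : T -> rVborel R n).
Proof.
move=> mh; apply: (@measurability _ _ T (rVborel R n) setT h (@open 'rV[R]_n)) => //.
move=> _ [A oA <-]; rewrite setTI (open_ratball_cover oA) preimage_bigcup.
apply: countable_bigcupT_measurable; first exact: countableP.
move=> [c k] /=; case: asboolP => _; last by rewrite preimage_set0.
rewrite [X in measurable X](_ : _ = \bigcap_(j in [set: 'I_n])
  ((fun t => h t ord0 j) @^-1` ball (ratr (c ord0 j) : R) k.+1%:R^-1)); last first.
  by apply/seteqP; split=> [t ht j _|t ht j]; [exact: ht|exact: (ht j)].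
apply: fin_bigcap_measurable => // j _; rewrite -[X in measurable X]setTI.
by apply: mh => //; apply: open_measurable; apply: ball_open.
Qed.

Lemma continuous_measurable_rVborel (f : 'rV[R]_n -> R) : continuous f ->
  measurable_fun setT (f : rVborel R n -> R).
Proof.
move=> /continuousP cf.
apply: (@measurability _ _ (rVborel R n) _ setT f _ (RGenOpens.measurableE R)).
by move=> _ [_ [a [b ->]] <-]; rewrite setTI; apply: sub_sigma_algebra; exact: cf.
Qed.

Lemma measurable_coord_rVborel (j : 'I_n) :
  measurable_fun setT (fun x : rVborel R n => (x : 'rV[R]_n) ord0 j).
Proof. by apply: continuous_measurable_rVborel; exact: coord_continuous. Qed.

End rV_borel.

(** * Integrating out an independent variable *)

Section freezing.
Local Open Scope ereal_scope.
Context d d1 d2 (T : measurableType d) (T1 : measurableType d1)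
  (T2 : measurableType d2) (R : realType) (P : probability T R).
Variables (X : T -> T1) (Y : T -> T2) (h : T1 * T2 -> \bar R).
Hypotheses (mX : measurable_fun setT X) (mY : measurable_fun setT Y).
Hypothesis indepXY : forall A B, measurable A -> measurable B ->
  P (X @^-1` A `&` Y @^-1` B) = P (X @^-1` A) * P (Y @^-1` B).
Hypotheses (mh : measurable_fun setT h) (h0 : forall p, 0 <= h p).

(* Freezing: [X] can be treated as a constant when integrating [Y] out. *)
Lemma ge0_integral_indep_le (phi : T1 -> \bar R) :
  measurable_fun setT phi -> (forall x, \int[P]_t h (x, Y t) <= phi x) ->
  \int[P]_t h (X t, Y t) <= \int[P]_t phi (X t).
Proof.
move=> mphi hphi.
pose X' : {mfun T >-> T1} := mfun_Sub (mem_set mX).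
pose Y' : {mfun T >-> T2} := mfun_Sub (mem_set mY).
pose XY : {mfun T >-> (T1 * T2)%type} :=
  mfun_Sub (mem_set (measurable_fun_pair mX mY)).
have -> : \int[P]_t h (X t, Y t) = \int[distribution P XY]_p h p.
  by rewrite (ge0_integral_distribution XY).
(* By independence the joint law agrees with the product of the marginals on rectangles, hence
   everywhere; Tonelli then applies. *)
have -> : \int[distribution P XY]_p h p =
    \int[distribution P X' \x distribution P Y']_p h p.
  apply: eq_measure_integral => A mA _; apply/esym.
  exact: product_measure_unique.
have phi0 x : 0 <= phi x.
  by apply: le_trans (hphi x); exact: integral_ge0.
have -> : \int[P]_t phi (X t) = \int[distribution P X']_x phi x.
  by rewrite (ge0_integral_distribution X').
rewrite fubini_tonelli1//; apply: ge0_le_integral => //.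
- by move=> x _; apply: integral_ge0.
- exact: measurable_fun_fubini_tonelli_F.
- move=> x _; rewrite /fubini_F (ge0_integral_distribution Y')//.
    exact: hphi.
  exact: measurableT_comp.
Qed.

End freezing.

(** * Measurability and integration of inner products *)

Section measurable_dotp.
Context {R : realType} {n : nat} d (T : measurableType d).

Lemma measurable_sqnorm2 (G : T -> 'rV[R]_n) :
  (forall j, measurable_fun setT (fun t => G t ord0 j)) ->
  measurable_fun setT (fun t => sqnorm2 (G t)).
Proof.
by move=> mG; apply: measurable_sum => j; apply: measurable_funM; exact: mG.
Qed.

Lemma integral_dotp (mu : {measure set T -> \bar R}) (v : 'rV[R]_n)
    (G : T -> 'rV[R]_n) (m : 'rV[R]_n) :
  (forall j, mu.-integrable setT (fun t => (G t ord0 j)%:E) /\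
    (\int[mu]_t (G t ord0 j)%:E = (m ord0 j)%:E)%E) ->
  mu.-integrable setT (fun t => (dotp v (G t))%:E) /\
  (\int[mu]_t (dotp v (G t))%:E = (dotp v m)%:E)%E.
Proof.
move=> hG; have -> : (fun t => (dotp v (G t))%:E) =
    (fun t => \sum_(j < n) (v ord0 j)%:E * (G t ord0 j)%:E)%E.
  by apply/funext => t; rewrite /dotp -sumEFin; apply: eq_bigr => j _.
have iG j : mu.-integrable setT (fun t => ((v ord0 j)%:E * (G t ord0 j)%:E)%E).
  by apply: integrableZl => //; case: (hG j).
split; first exact: integrable_sum.
rewrite integral_sum// /dotp -sumEFin; apply: eq_bigr => j _.
by have [ij vj] := hG j; rewrite integralZl// vj EFinM.
Qed.

End measurable_dotp.

(** * Expected effect of one SGD step from a fixed point *)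

Section sgd_step.
Context {R : realType} {n : nat} d (T : measurableType d)
  (P : probability T R).
Variables (f : 'rV[R]_n -> R) (grad : 'rV[R]_n -> 'rV[R]_n) (L s2 : R).
Hypotheses (L0 : 0 < L) (cf : continuous f) (sm : L_smooth f grad L).
Variables (wstar : 'rV[R]_n) (hmin : forall w, f wstar <= f w).
Variables (w : 'rV[R]_n) (G : T -> 'rV[R]_n).
Hypothesis unbiased : forall j, P.-integrable setT (fun t => (G t ord0 j)%:E) /\
  (\int[P]_t (G t ord0 j)%:E = (grad w ord0 j)%:E)%E.
Hypothesis variance : (\int[P]_t (sqnorm2 (G t - grad w))%:E <= s2%:E)%E.

(** The smoothness bound is integrated after splitting [sqnorm2 (G t)] into the deviation [V t] and
    a term linear in [G t], controlled by the variance and by unbiasedness. Subtracting [f wstar]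
    keeps the integrand nonnegative, so the integrals can be compared without first knowing that the
    left one is finite. *)
Lemma sgd_step_expectation (a : R) :
  (\int[P]_t (f (w - (a / L) *: G t) - f wstar)%:E <=
   (f w - f wstar + (a ^+ 2 / (2 * L) - a / L) * sqnorm2 (grad w) +
     a ^+ 2 / (2 * L) * s2)%:E)%E.
Proof.
pose C := a ^+ 2 / (2 * L); rewrite -/C.
have C0 : 0 <= C by rewrite divr_ge0 ?sqr_ge0// mulr_ge0// ltW.
have mG j : measurable_fun setT (fun t => G t ord0 j).
  by have [/measurable_int /measurable_EFinP] := unbiased j.
pose V t := sqnorm2 (G t - grad w).
have mV : measurable_fun setT V.
  apply: measurable_sqnorm2 => j.
  rewrite (_ : (fun t => _) = (fun t => G t ord0 j - grad w ord0 j)).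
    by apply: measurable_funB => //; exact: mG.
  by apply/funext => t; rewrite !mxE.
have iV : P.-integrable setT (EFin \o V).
  apply/integrableP; split; first exact/measurable_EFinP.
  under eq_integral do rewrite /= ger0_norm ?sqnorm2_ge0//.
  by apply: le_lt_trans variance _; rewrite ltry.
pose X t := dotp (grad w) (G t).
have [iX EX] := integral_dotp (grad w) unbiased.
(* [A], [B] and [C] are the coefficients of 1, [X] and [V] in the upper bound. *)
pose A := f w - f wstar - C * sqnorm2 (grad w).
pose B := 2 * C - a / L.
have hU t : f (w - (a / L) *: G t) - f wstar <= A + (B * X t + C * V t).
  have := L_smooth_step a w (G t) L0 sm; rewrite -/C.
  have -> : sqnorm2 (G t) = V t + 2 * X t - sqnorm2 (grad w).
    by rewrite /V sqnorm2D sqnorm2N dotpNr dotpC -/(X t); ring.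
  by rewrite /A /B -/(X t); lra.
have iBX : P.-integrable setT (fun t => (B%:E * (X t)%:E)%E).
  exact: integrableZl.
have iCV : P.-integrable setT (fun t => (C%:E * (V t)%:E)%E).
  exact: integrableZl.
have iA := finite_measure_integrable_cst P A measurableT.
apply: (@le_trans _ _ (\int[P]_t (A%:E + (B%:E * (X t)%:E + C%:E * (V t)%:E)))%E).
  apply: ge0_le_integral => //.
  - by move=> t _; rewrite lee_fin subr_ge0.
  - apply/measurable_EFinP/measurable_funB => //.
    apply: (@measurableT_comp _ _ _ _ (rVborel R n) _ f setT
              (fun t => w - (a / L) *: G t)).
      exact: continuous_measurable_rVborel.
    apply: measurable_rVborel => j.
    rewrite (_ : (fun t => _) = (fun t => w ord0 j - (a / L) * G t ord0 j)).
      by apply: measurable_funB => //; apply: measurable_funM => //; exact: mG.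
    by apply/funext => t; rewrite !mxE.
  - exact: (measurable_int _ (integrableD measurableT iA
              (integrableD measurableT iBX iCV))).
  - by move=> t _; rewrite -!EFinM -!EFinD lee_fin.
rewrite (integralD measurableT iA (integrableD measurableT iBX iCV)).
rewrite (integralD measurableT iBX iCV) integralZl// integralZl// EX.
have -> : (\int[P]_t (EFin \o cst A) t = A%:E)%E.
  by have := integral_cst P measurableT A%:E; rewrite /= probability_setT mule1.
apply: (@le_trans _ _ (A%:E + (B%:E * (sqnorm2 (grad w))%:E + C%:E * s2%:E))%E).
  by rewrite leeD2l// leeD2l// lee_wpmul2l// lee_fin.
rewrite -!EFinM -!EFinD lee_fin /A /B; lra.
Qed.

End sgd_step.

(** * Measurability with respect to a sub-sigma-algebra *)

Section measurable_wrt_theory.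
Context d (T : measurableType d).
Implicit Types F : set (set T).

(** A sigma-algebra generates itself, so closure properties of [measurable_fun] transfer to each
    member of the filtration. *)
Lemma measurable_wrtP F dX (X : measurableType dX) (h : T -> X) :
  sigma_algebra setT F ->
  measurable_wrt F h <->
  measurable_fun setT (h : g_sigma_algebraType F -> X).
Proof.
move=> sF; have FE := measurable_g_measurableTypeE sF.
split=> [hh _ B mB|hh B mB].
  by rewrite setTI FE; exact: hh.
by have := hh measurableT B mB; rewrite setTI FE.
Qed.

Lemma measurable_wrtS F F' dX (X : measurableType dX) (h : T -> X) :
  F `<=` F' -> measurable_wrt F h -> measurable_wrt F' h.
Proof. by move=> FF' hh B mB; exact/FF'/hh. Qed.

Lemma measurable_wrt_fun F dX (X : measurableType dX) (h : T -> X) :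
  F `<=` measurable -> measurable_wrt F h -> measurable_fun setT h.
Proof. by move=> FT hh _ B mB; rewrite setTI; exact/FT/hh. Qed.

Lemma rV_measurable_wrt_rVborel F (R : realType) n (h : T -> 'rV[R]_n) :
  sigma_algebra setT F ->
  rV_measurable_wrt F h -> measurable_wrt F (h : T -> rVborel R n).
Proof.
move=> sF hh; apply/measurable_wrtP => //; apply: measurable_rVborel => j.
exact/measurable_wrtP.
Qed.

End measurable_wrt_theory.

(** * Measurability of the guarded update *)

Section guarded_step.
Context {R : realType} {n : nat} d (T : measurableType d)
  dX (Xi : measurableType dX).
Variables (f : 'rV[R]_n -> R) (g : 'rV[R]_n -> Xi -> 'rV[R]_n) (a : R).
Hypothesis cf : continuous f.
Hypothesis mg : forall j : 'I_n, measurable_fun setT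
  (fun p : (rVborel R n * Xi)%type => g p.1 p.2 ord0 j).

Lemma measurable_sgd :
  measurable_fun setT
    (fun p : (rVborel R n * Xi)%type => (p.1 - a *: g p.1 p.2 : rVborel R n)).
Proof.
apply: measurable_rVborel => j.
rewrite (_ : (fun p => _) =
    (fun p => (p.1 : 'rV[R]_n) ord0 j - a * g p.1 p.2 ord0 j)); last first.
  by apply/funext => p; rewrite !mxE.
apply: measurable_funB; last exact: measurable_funM.
apply: (@measurableT_comp _ _ _ _ _ _
  (fun x : rVborel R n => (x : 'rV[R]_n) ord0 j) setT fst).
  exact: measurable_coord_rVborel.
exact: measurable_fst.
Qed.

(** The domain [T] is left arbitrary so that it can be [Omega] equipped with the sigma-algebra
    [F i.+1]. *)
Lemma measurable_guarded_step (w y : T -> rVborel R n) (x : T -> Xi) :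
  measurable_fun setT w -> measurable_fun setT y -> measurable_fun setT x ->
  measurable_fun setT (fun t => let z := w t - a *: g (w t) (x t) in
    if f (y t) < f z then y t else z : rVborel R n).
Proof.
move=> mw my mx /=.
have mz : measurable_fun setT (fun t => w t - a *: g (w t) (x t) : rVborel R n).
  apply: (measurableT_comp measurable_sgd (measurable_fun_pair mw mx)).
have mf := continuous_measurable_rVborel cf.
apply: measurable_fun_ifT => //; apply: measurable_fun_ltr.
  exact: (measurableT_comp mf my).
exact: (measurableT_comp mf mz).
Qed.

End guarded_step.

(** * The expected optimality gap along the iterates *)

Section lgl2o_recursion.
Context {R : realType} {n : nat}.
Variables (f : 'rV[R]_n -> R) (grad : 'rV[R]_n -> 'rV[R]_n) (mu L : R).
Hypotheses (hmu : 0 < mu) (hL : 0 < L) (hcont : continuous f).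
Hypotheses (hsc : strongly_convex f grad mu) (hsm : L_smooth f grad L).
Variables (wstar : 'rV[R]_n) (hmin : forall w, f wstar <= f w).
Context d (Omega : measurableType d) (P : probability Omega R).
Variables (F : nat -> set (set Omega)) (hF : filtration F).
Context dX (Xi : measurableType dX).
Variable g : 'rV[R]_n -> Xi -> 'rV[R]_n.
Hypothesis hg_meas : forall j : 'I_n, measurable_fun setT
  (fun p : (rVborel R n * Xi)%type => g p.1 p.2 ord0 j).
Variable xi : nat -> Omega -> Xi.
Hypothesis hxi_meas : forall i, measurable_wrt (F i.+1) (xi i).
Hypothesis hxi_indep : forall i, indep_of P (xi i) (F i).
Hypothesis hunb : forall i w (j : 'I_n),
  P.-integrable setT (fun om => (g w (xi i om) ord0 j)%:E) /\
  (\int[P]_om (g w (xi i om) ord0 j)%:E = (grad w ord0 j)%:E)%E.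
Variable sigma2 : R.
Hypothesis hvar : forall i w,
  (\int[P]_om (sqnorm2 (g w (xi i om) - grad w))%:E <= sigma2%:E)%E.
Variable y : nat -> Omega -> 'rV[R]_n.
Hypothesis hy : forall i, rV_measurable_wrt (F i.+1) (y i).
Variables (w0 : 'rV[R]_n) (alpha : nat -> R).

Local Notation W := (lgl2o f g L alpha y xi w0).

(** Each iterate is a measurable function of the previous iterate, proposal and sample. Adaptedness
    makes [W i] independent of the fresh sample [xi i]. *)
Lemma lgl2o_adapted i :
  measurable_wrt (F i) (W i : Omega -> rVborel R n).
Proof.
have [sF [_ FS]] := hF.
elim: i => [|i IH]; first by apply/measurable_wrtP => //; exact: measurable_cst.
apply/measurable_wrtP => //=.
apply: (@measurable_guarded_step _ _ _
  (g_sigma_algebraType (F i.+1)) _ _ f g _ hcont hg_meas).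
- by apply/measurable_wrtP => //; apply: measurable_wrtS IH.
- by apply/measurable_wrtP => //; exact: rV_measurable_wrt_rVborel.
- exact/measurable_wrtP.
Qed.

Local Notation gap i := (\int[P]_om (f (W i om) - f wstar)%:E)%E.

Let mW i : measurable_fun setT (W i : Omega -> rVborel R n).
Proof.
by have [_ [FT _]] := hF; apply: measurable_wrt_fun (lgl2o_adapted i).
Qed.

Let mf_gap :
  measurable_fun setT (fun x : rVborel R n => (f x - f wstar)%:E).
Proof.
apply/measurable_EFinP/measurable_funB => //.
exact: continuous_measurable_rVborel.
Qed.

Lemma measurable_gap i :
  measurable_fun setT (fun om => (f (W i om) - f wstar)%:E).
Proof. exact: (measurableT_comp mf_gap (mW i)). Qed.

Lemma sigma2_ge0 : 0 <= sigma2.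
Proof.
rewrite -lee_fin; apply: le_trans (hvar 0%N w0).
by apply: integral_ge0 => om _; rewrite lee_fin sqnorm2_ge0.
Qed.

(** The factor [rho] is abstract because the step is used twice: with [1 + alpha i ^+ 2] for
    finiteness and with [1 - alpha i * kappa] for contraction. *)
Lemma lgl2o_gap_step i (rho : R) : 0 <= rho ->
  (forall w, f w - f wstar +
    (alpha i ^+ 2 / (2 * L) - alpha i / L) * sqnorm2 (grad w) <=
    rho * (f w - f wstar)) ->
  (gap i.+1 <= rho%:E * gap i + (alpha i ^+ 2 / (2 * L) * sigma2)%:E)%E.
Proof.
move=> rho0 hrho; set K := alpha i ^+ 2 / (2 * L) * sigma2.
have [_ [FT _]] := hF.
have mxi := measurable_wrt_fun (FT _) (hxi_meas i).
have K0 : 0 <= K.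
  by rewrite mulr_ge0 ?sigma2_ge0// divr_ge0 ?sqr_ge0// mulr_ge0// ltW.
pose h (p : rVborel R n * Xi) :=
  (f (p.1 - (alpha i / L) *: g p.1 p.2) - f wstar)%:E.
have mh : measurable_fun setT h.
  exact: (measurableT_comp mf_gap (measurable_sgd (alpha i / L) hg_meas)).
have h0 p : (0 <= h p)%E by rewrite lee_fin subr_ge0.
pose phi (w : rVborel R n) := (rho%:E * (f w - f wstar)%:E + K%:E)%E.
have mphi : measurable_fun setT phi.
  by apply: emeasurable_funD => //; exact: measurable_funeM.
(* Under either outcome of the guard, [f] at the next iterate is at most its value at the SGD
   fallback. *)
apply: (@le_trans _ _ (\int[P]_om h (W i om, xi i om))%E).
  apply: ge0_le_integral => //.
  - by move=> om _; rewrite lee_fin subr_ge0.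
  - exact: measurable_gap.
  - exact: (measurableT_comp mh (measurable_fun_pair (mW i) mxi)).
  - move=> om _; rewrite lee_fin lerD2r /=.
    by case: ifPn => // /ltW.
(* Freezing [W i] reduces the bound to the one-step estimate at a fixed point. *)
apply: (@le_trans _ _ (\int[P]_om phi (W i om))%E).
  apply: (@ge0_integral_indep_le _ _ _ _ (rVborel R n) Xi _ P (W i) (xi i) h) => //.
    move=> A B mA mB; apply: hxi_indep => //.
    exact: lgl2o_adapted.
  move=> w; apply: le_trans (sgd_step_expectation hL hcont hsm hmin
    (hunb i w) (hvar i w) (alpha i)) _.
  by rewrite /phi -EFinM -EFinD lee_fin lerD2r.
have gap0 om : (0 <= (f (W i om) - f wstar)%:E)%E.
  by rewrite lee_fin subr_ge0.
rewrite /phi ge0_integralD//; last 2 first.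
- by move=> om _; apply: mule_ge0.
- by apply: measurable_funeM; exact: measurable_gap.
rewrite ge0_integralZl_EFin//; last exact: measurable_gap.
by have := integral_cst P measurableT K%:E; rewrite /= probability_setT mule1 => ->.
Qed.

Lemma lgl2o_gap_ge0 i : (0 <= gap i)%E.
Proof. by apply: integral_ge0 => om _; rewrite lee_fin subr_ge0. Qed.

(** [fine] sends infinity to 0, so finiteness at every step is what makes the passage to a real
    recursion faithful. The induction starts from the deterministic [w0]. *)
Lemma lgl2o_gap_fin_num : (forall i, 0 <= alpha i) ->
  forall i, gap i \is a fin_num.
Proof.
move=> a0; elim=> [|i IH].
  rewrite /= (integral_cst P measurableT (f w0 - f wstar)%:E).
  by rewrite /= probability_setT mule1.
rewrite ge0_fin_numE ?lgl2o_gap_ge0//.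
have rho0 : 0 <= 1 + alpha i ^+ 2 by rewrite addr_ge0 ?sqr_ge0.
apply: le_lt_trans (lgl2o_gap_step rho0 _) _.
  by move=> w; exact: descent_le.
by rewrite -(fineK IH) -EFinM -EFinD ltry.
Qed.

Lemma lgl2o_gap_cvg0 (c i0 : R) : 0 < c -> 0 < i0 ->
  (forall i, alpha i = c / (i0 + i%:R)) ->
  (fun i => fine (gap i)) @ \oo --> (0 : R).
Proof.
move=> c0 i00 halpha.
have t0 i : 0 < i0 + i%:R :> R by rewrite ltr_pwDl.
have a0 i : 0 <= alpha i by rewrite halpha divr_ge0// ltW.
have gfin := lgl2o_gap_fin_num a0.
pose kappa := Num.min (mu / L) 1.
have kappa0 : 0 < kappa by rewrite lt_min divr_gt0//=.
have kappa1 : kappa <= 1 by rewrite ge_min lexx orbT.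
(* [N > c], so [c / (i0 + i%:R) <= 1] once [N <= i]. *)
pose N := (Num.truncn c).+1.
have a1 i : (N <= i)%N -> alpha i <= 1.
  move=> Ni; rewrite halpha ler_pdivrMr// mul1r.
  apply: (@le_trans _ _ N%:R); first exact: ltW (truncnS_gt _).
  apply: (@le_trans _ _ i%:R); first by rewrite ler_nat.
  by rewrite lerDr ltW.
have ak i : c * kappa / (i0 + i%:R) = alpha i * kappa.
  by rewrite halpha mulrAC.
have ak1 i : (N <= i)%N -> alpha i * kappa <= 1.
  by move=> Ni; apply: mulr_ile1 => //; [exact: ltW|exact: a1].
apply: (@sgd_recursion_cvg0 _ _ (c * kappa) (c ^+ 2 / (2 * L) * sigma2) i0 N) => //.
- exact: mulr_gt0.
- by rewrite mulr_ge0 ?sigma2_ge0// divr_ge0 ?sqr_ge0// mulr_ge0// ltW.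
- by move=> i; rewrite fine_ge0// lgl2o_gap_ge0.
- by move=> i Ni; rewrite ak ak1.
move=> i Ni; rewrite ak.
have rho0 : 0 <= 1 - alpha i * kappa by rewrite subr_ge0 ak1.
have := @lgl2o_gap_step i _ rho0.
rewrite -(fineK (gfin i)) -(fineK (gfin i.+1)) -EFinM -EFinD lee_fin.
have -> : c ^+ 2 / (2 * L) * sigma2 / (i0 + i%:R) ^+ 2 =
    alpha i ^+ 2 / (2 * L) * sigma2.
  rewrite halpha; field; rewrite gt_eqF//=; exact: lt0r_neq0.
by apply=> w; apply: descent_contract => //; rewrite a0 a1.
Qed.

Lemma lgl2o_sqdist_le i :
  (\int[P]_om (sqnorm2 (W i om - wstar))%:E <= (2 / mu)%:E * gap i)%E.
Proof.
have m0 : 0 <= 2 / mu by rewrite divr_ge0// ltW.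
rewrite -ge0_integralZl_EFin//; last 2 first.
- by move=> om _; rewrite lee_fin subr_ge0.
- exact: measurable_gap.
apply: ge0_le_integral => //.
- by move=> om _; rewrite lee_fin sqnorm2_ge0.
- apply/measurable_EFinP/measurable_sqnorm2 => j.
  rewrite (_ : (fun t => _) = (fun t => W i t ord0 j - wstar ord0 j)).
    apply: measurable_funB => //.
    exact: (measurableT_comp (measurable_coord_rVborel j) (mW i)).
  by apply/funext => t; rewrite !mxE.
- by apply: measurable_funeM; exact: measurable_gap.
- move=> om _; rewrite -EFinM lee_fin mulrC -ler_pdivrMr ?divr_gt0//.
  rewrite invf_div mulrC; exact: quadratic_growth hL hsc hsm hmin.
Qed.

End lgl2o_recursion.

(** * Convergence of the iterates in mean square *)

Theorem theorem4
  (R : realType) (n : nat)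
  (* loss function, its gradient, constants *)
  (f : 'rV[R]_n -> R) (grad : 'rV[R]_n -> 'rV[R]_n) (mu L : R)
  (hmu : 0 < mu) (hL : 0 < L)
  (hcont : continuous f)
  (hgrad : is_gradient f grad)
  (hsc : strongly_convex f grad mu)
  (hsm : L_smooth f grad L)
  (wstar : 'rV[R]_n) (hmin : forall w, f wstar <= f w)
  (* probability space and filtration (information available before step i) *)
  (d : measure_display) (Omega : measurableType d) (P : probability Omega R)
  (F : nat -> set (set Omega)) (hF : filtration F)
  (* mini-batch stochastic gradient: g w s for a sample s *)
  (dX : measure_display) (Xi : measurableType dX)
  (g : 'rV[R]_n -> Xi -> 'rV[R]_n)
  (hg_meas : forall j : 'I_n,
     measurable_fun setT (fun p : (rVborel R n * Xi)%type => g p.1 p.2 ord0 j))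
  (* freshly sampled mini-batches *)
  (xi : nat -> Omega -> Xi)
  (hxi_meas : forall i, measurable_wrt (F i.+1) (xi i))
  (hxi_indep : forall i, indep_of P (xi i) (F i))
  (* unbiasedness *)
  (hunb : forall i w (j : 'I_n),
     P.-integrable setT (fun om => (g w (xi i om) ord0 j)%:E) /\
     (\int[P]_om (g w (xi i om) ord0 j)%:E = (grad w ord0 j)%:E)%E)
  (* bounded variance *)
  (sigma2 : R)
  (hvar : forall i w,
     (\int[P]_om (sqnorm2 (g w (xi i om) - grad w))%:E <= sigma2%:E)%E)
  (* arbitrary black-box proposals, using only information up to step i *)
  (y : nat -> Omega -> 'rV[R]_n)
  (hy : forall i, rV_measurable_wrt (F i.+1) (y i))
  (* initial point and step sizes alpha_i / L with alpha_i = c / (i0 + i) *)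
  (w0 : 'rV[R]_n) (c i0 : R) (hc : 0 < c) (hi0 : 0 < i0)
  (alpha : nat -> R) (halpha : forall i, alpha i = c / (i0 + i%:R)) :
  (fun i => (\int[P]_om
       (sqnorm2 (lgl2o f g L alpha y xi w0 i om - wstar))%:E)%E)
    @ \oo --> (0%:E : \bar R).
Proof.
have a0 i : 0 <= alpha i.
  by rewrite halpha divr_ge0 ?ltW// ltr_pwDl.
have gfin := lgl2o_gap_fin_num hL hcont hsm hmin hF hg_meas hxi_meas hxi_indep
  hunb hvar hy w0 a0.
have gcvg := lgl2o_gap_cvg0 hmu hL hcont hsc hsm hmin hF hg_meas hxi_meas
  hxi_indep hunb hvar hy w0 hc hi0 halpha.
set gap := (fun i => fine _) in gcvg.
(* The mean squared distance is squeezed between 0 and [2 / mu] times the expected gap. *)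
apply: (@squeeze_cvge _ _ _ _ (cst 0%E) _ (fun i => (2 / mu * gap i)%:E)).
- apply: nearW => i; apply/andP; split.
    by apply: integral_ge0 => om _; rewrite lee_fin sqnorm2_ge0.
  rewrite EFinM fineK//.
  exact: (lgl2o_sqdist_le hmu hL hcont hsc hsm hmin P hF hg_meas hxi_meas hy).
- exact: cvg_cst.
- apply: cvg_EFin; first exact: nearW.
  rewrite -[X in _ --> X](mulr0 (2 / mu)); exact: cvgMr.
Qed.
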